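(* Let $\mathcal{H}$ be a Hilbert space, $\mathbb{S}_{\mathcal{H}}$ its unit sphere with the uniformity of the norm distance, and $U(\mathcal{H})$ the group of all unitary operators on $\mathcal{H}$, acting on $\mathbb{S}_{\mathcal{H}}$ in the natural way. Then the pair $(\mathbb{S}_{\mathcal{H}},U(\mathcal{H}))$ does not have the concentration property.
   Context: Hilbert spaces are complex. Let $X=(X,\mathcal{U}_X)$ be a uniform space and let a group $G$ act on $X$ by uniform isomorphisms. For $A\subseteq X$ and $V\in\mathcal{U}_X$, $V[A]$ denotes the $V$-neighbourhood of $A$. The pair $(X,G)$ has the concentration property if every finite cover $\gamma$ of $X$ (by arbitrary subsets) contains an element $A\in\gamma$ such that for every $V\in\mathcal{U}_X$ and every finite collection $g_1,\dots,g_n\in G$, $n\geq 1$, one has $\bigcap_{i=1}^n g_i(V[A])\neq\emptyset$. *)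

(* Defs.v *)
From HB Require Import structures.
From mathcomp Require Import all_boot all_order all_algebra sesquilinear.
From mathcomp Require Import complex.
From mathcomp Require Import all_classical all_reals topology normedtype.

Set Implicit Arguments.
Unset Strict Implicit.
Unset Printing Implicit Defensive.

Import Order.TTheory GRing.Theory Num.Theory.
Import numFieldNormedType.Exports.

Local Open Scope classical_set_scope.
Local Open Scope ring_scope.

(* {dot H for conjC}: positive definite Hermitian form, linear in the first
   argument and conjugate-linear in the second. The library's norm on a normed
   module over R[i] is R[i]-valued, with values in the nonnegative reals. *)
HB.mixin Record NormedModule_isHilbert (R : realType) H
    & NormedModule R[i] H := {
  inner : {dot H for @Num.conj R[i]};
  inner_norm : forall x : H, `|x| ^+ 2 = inner x x
}.

#[short(type="hilbertType")]
HB.structure Definition Hilbert (R : realType) :=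
  {H of CompleteNormedModule R[i] H & NormedModule_isHilbert R H}.

Definition uniform_isomorphism (X Y : uniformType) (f : X -> Y) : Prop :=
  exists g : Y -> X,
    [/\ cancel f g, cancel g f, unif_continuous f & unif_continuous g].

Record uniform_action (G : groupType) (X : uniformType) := UniformAction {
  uact :> G -> X -> X;
  uact1 : forall x, uact 1%g x = x;
  uactM : forall g h x, uact (g * h)%g x = uact g (uact h x);
  uact_iso : forall g, uniform_isomorphism (uact g)
}.

(* V[A] *)
Definition entourage_nbhd (X : Type) (V : set (X * X)) (A : set X) : set X :=
  [set y | exists2 x, A x & V (x, y)].

Definition concentration_property (X : uniformType) (G : groupType)
    (act : uniform_action G X) : Prop :=
  forall gamma : set (set X),
    finite_set gamma -> \bigcup_(A in gamma) A = [set: X] ->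
    exists2 A, gamma A &
      forall V : set (X * X), entourage V ->
      forall (n : nat) (g : 'I_n -> G), (0 < n)%N ->
        \bigcap_(i in [set: 'I_n]) (act (g i) @` entourage_nbhd V A) !=set0.

(* As the coercion of a set to a type, this carries the uniformity induced
   from the norm uniformity of H. *)
Definition unit_sphere (R : realType) (H : hilbertType R) : set H :=
  [set x | `|x| = 1].

Definition unitary (R : realType) (H : hilbertType R) : set (H -> H) :=
  [set u | [/\ linear u, bijective u & isometry (@inner R H) (@inner R H) u]].

Definition unitary_group (R : realType) (H : hilbertType R) : Type :=
  unitary (H := H).

Section UnitaryGroup.
Variables (R : realType) (H : hilbertType R).
Local Notation U := (unitary_group H).

HB.instance Definition _ := Choice.copy U (set_type (unitary (H := H))).

Definition unitary_fun (u : U) : H -> H := \val u.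

Lemma unitary_funP (u : U) : unitary (unitary_fun u).
Proof. exact: set_valP. Qed.

Lemma unitary_inj (u v : U) : unitary_fun u =1 unitary_fun v -> u = v.
Proof. by move=> uv; apply/val_inj/funext. Qed.

Lemma unitary_id : unitary (H := H) id.
Proof. by split=> //; exists id. Qed.

Lemma unitary_comp (u v : H -> H) : unitary u -> unitary v -> unitary (u \o v).
Proof.
move=> [lu bu iu] [lv bv iv]; split; last by move=> x y /=; rewrite iu iv.
  by move=> a x y /=; rewrite lv lu.
exact: bij_comp.
Qed.

Lemma unitary_inv_ex (u : U) :
  exists v : U, cancel (unitary_fun u) (unitary_fun v) /\
                cancel (unitary_fun v) (unitary_fun u).
Proof.
have [lu [v uK vK] iu] := unitary_funP u.
suff vP : unitary v by exists (exist _ v (mem_set vP)).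
split; last by move=> x y; rewrite -iu !vK.
  by move=> a x y; apply: (can_inj uK); rewrite lu !vK.
by exists (unitary_fun u).
Qed.

Definition unitary_one : U := exist _ id (mem_set unitary_id).

Definition unitary_mul (u v : U) : U :=
  exist _ (unitary_fun u \o unitary_fun v)
    (mem_set (unitary_comp (unitary_funP u) (unitary_funP v))).

Definition unitary_inv (u : U) : U := projT1 (cid (unitary_inv_ex u)).

Lemma unitary_mulA : associative unitary_mul.
Proof. by move=> u v w; apply: unitary_inj. Qed.

Lemma unitary_1mul : left_id unitary_one unitary_mul.
Proof. by move=> u; apply: unitary_inj. Qed.

Lemma unitary_mul1 : right_id unitary_one unitary_mul.
Proof. by move=> u; apply: unitary_inj. Qed.

Lemma unitary_Vmul : left_inverse unitary_one unitary_inv unitary_mul.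
Proof.
move=> u; apply: unitary_inj => x.
by rewrite /unitary_inv; case: cid => v [uK vK]; exact: uK.
Qed.

Lemma unitary_mulV : right_inverse unitary_one unitary_inv unitary_mul.
Proof.
move=> u; apply: unitary_inj => x.
by rewrite /unitary_inv; case: cid => v [uK vK]; exact: vK.
Qed.

HB.instance Definition _ := isGroup.Build U unitary_mulA unitary_1mul
  unitary_mul1 unitary_Vmul unitary_mulV.

Lemma unitary_norm (u : U) (x : H) : `|unitary_fun u x| = `|x|.
Proof.
have [_ _ iu] := unitary_funP u.
by apply/eqP; rewrite -(eqrXn2 (n := 2)) // !inner_norm iu.
Qed.

Lemma unitary_sphere_subproof (u : U) (x : unit_sphere (H := H)) :
  unitary_fun u (\val x) \in unit_sphere (H := H).
Proof.
by apply/mem_set; rewrite /unit_sphere/= unitary_norm; exact: set_mem (valP x).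
Qed.

Definition sphere_act (u : U) (x : unit_sphere (H := H)) :
  unit_sphere (H := H) :=
  exist _ (unitary_fun u (\val x)) (unitary_sphere_subproof u x).

Lemma sphere_act1 x : sphere_act 1%g x = x.
Proof. exact: val_inj. Qed.

Lemma sphere_actM (u v : U) x :
  sphere_act (u * v)%g x = sphere_act u (sphere_act v x).
Proof. exact: val_inj. Qed.

Lemma sphere_act_unif (u : U) : unif_continuous (sphere_act u).
Proof.
have [lu _ _] := unitary_funP u.
move=> A [B entB BA].
move: entB; rewrite -entourage_ballE => -[e /= e0 eB].
exists [set xy | ball xy.1 e xy.2].
  by rewrite -entourage_ballE; exists e.
move=> [x y] /= xy; apply: BA => /=; apply: eB => /=.
rewrite -ball_normE /=.
move: xy; rewrite -ball_normE /=.
by rewrite -(unitary_norm u) (_ : unitary_fun u (_ - _) =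
  unitary_fun u (\val x) - unitary_fun u (\val y))// addrC -scaleN1r lu scaleN1r addrC.
Qed.

Lemma sphere_act_iso (u : U) : uniform_isomorphism (sphere_act u).
Proof.
exists (sphere_act u^-1%g); split; try exact: sphere_act_unif.
  by move=> x; rewrite -sphere_actM mulVg sphere_act1.
by move=> x; rewrite -sphere_actM mulgV sphere_act1.
Qed.

Definition unitary_sphere_action :
    uniform_action (unitary_group H) (unit_sphere (H := H)) :=
  UniformAction sphere_act1 sphere_actM sphere_act_iso.

End UnitaryGroup.

(* Main.v *)
(* A finite cover with no concentrated member is built from an orthonormal basis
   of the form { f(t) : f in Z, t in T } together with finitely many vectors
   v_1, ..., v_d, where T = bool * seq nat and Z is a maximal set of mutually
   orthogonal orthonormal families indexed by T; the remainder is finite because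
   an infinite one would contain another such family. Every unit vector has mass
   at least 1/4 on the basis vectors of colour true, or on those of colour
   false, or else its coordinate along some v_k has a real or imaginary part
   bounded away from 0. A set of the last kind (with a prescribed sign) is moved
   off itself by -1. For the first two, involutions of T carry the words of one
   colour onto pairwise disjoint sets of words, so 17 unitary translates of a
   neighbourhood meeting in a unit vector would give it mass at least
   17 * (1/16) > 1, against Bessel's inequality. If H has finite dimension then
   Z is empty and only the sets of the last kind matter. *)

Require Import Defs.
From mathcomp Require Import all_boot all_order all_algebra sesquilinear.
From mathcomp Require Import complex finmap ring lra.
From mathcomp Require Import all_classical all_reals topology normedtype.

Set Implicit Arguments.
Unset Strict Implicit.
Unset Printing Implicit Defensive.

Import Order.TTheory GRing.Theory Num.Theory.
Import numFieldNormedType.Exports.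

Local Open Scope classical_set_scope.
Local Open Scope ring_scope.

(** * Inner product calculus, orthonormal families and Bessel's inequality *)

Definition ip (R : realType) (H : hilbertType R) (x y : H) : R[i] := inner x y.

Local Notation "'[ x , y ]" := (ip x y).

Section Inner.
Variables (R : realType) (H : hilbertType R).
Implicit Types (x y z : H) (a : R[i]).

Lemma norm_ip x : `|x| ^+ 2 = '[x, x].
Proof. exact: inner_norm. Qed.

Lemma ipDl x y z : '[x + y, z] = '[x, z] + '[y, z].
Proof. exact: linearDl. Qed.

Lemma ipDr x y z : '[x, y + z] = '[x, y] + '[x, z].
Proof. exact: linearDr. Qed.

Lemma ipBl x y z : '[x - y, z] = '[x, z] - '[y, z].
Proof. exact: linearBl. Qed.

Lemma ipBr x y z : '[x, y - z] = '[x, y] - '[x, z].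
Proof. exact: linearBr. Qed.

Lemma ipNl x y : '[- x, y] = - '[x, y].
Proof. exact: linearNl. Qed.

Lemma ipNr x y : '[x, - y] = - '[x, y].
Proof. exact: linearNr. Qed.

Lemma ipZl a x y : '[a *: x, y] = a * '[x, y].
Proof. exact: linearZl_LR. Qed.

Lemma ipZr a x y : '[x, a *: y] = a^* * '[x, y].
Proof. exact: linearZr_LR. Qed.

Lemma ipC x y : '[x, y] = '[y, x]^*.
Proof. by rewrite /ip (hermC (@inner R H)) expr0 mul1r. Qed.

Lemma ip_suml I (r : seq I) (P : pred I) (F : I -> H) y :
  '[\sum_(i <- r | P i) F i, y] = \sum_(i <- r | P i) '[F i, y].
Proof. exact: linear_sumlz. Qed.

Lemma ip_sumr I (r : seq I) (P : pred I) (F : I -> H) x :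
  '[x, \sum_(i <- r | P i) F i] = \sum_(i <- r | P i) '[x, F i].
Proof. exact: linear_sumr. Qed.

Lemma ip_ge0 x : 0 <= '[x, x].
Proof. exact: (dnorm_ge0 (@inner R H)). Qed.

Lemma ip_eq0 x : ('[x, x] == 0) = (x == 0).
Proof. exact: (dnorm_eq0 (@inner R H)). Qed.

Lemma unit_norm_ip x : `|x| = 1 <-> '[x, x] = 1.
Proof.
rewrite -norm_ip; split=> [->|/eqP]; first by rewrite expr1n.
by rewrite sqrf_eq1 => /orP[/eqP//|/eqP x1]; have := normr_ge0 x;
  rewrite x1 oppr_ge0 ler10.
Qed.

Lemma ball_ip x y (a : R[i]) : 0 < a -> ball x a y <-> '[x - y, x - y] < a ^+ 2.
Proof.
move=> a0; rewrite -norm_ip -ball_normE /=; split=> [xy|].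
  by rewrite ltr_pXn2r ?nnegrE// ltW.
by rewrite ltr_pXn2r ?nnegrE// ltW.
Qed.

Section Orthonormal.
Variable J : eqType.
Implicit Types (e : J -> H).

Definition orthonormal_family e := forall i j, '[e i, e j] = (i == j)%:R.

Lemma ip_sum_orthonormal_coef e (c : J -> R[i]) s i :
  orthonormal_family e -> uniq s ->
  '[\sum_(j <- s) c j *: e j, e i] = if i \in s then c i else 0.
Proof.
move=> oe us; rewrite ip_suml.
under eq_bigr do rewrite ipZl oe.
case: ifP => [si|/negbT si].
  rewrite (bigD1_seq i)//= eqxx mulr1 big1 ?addr0// => j ji.
  by rewrite (negbTE ji) mulr0.
rewrite big_seq big1// => j sj; rewrite (negbTE (_ : j != i)) ?mulr0//.
by apply: contraNneq si => <-.
Qed.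

Lemma ip_sum_orthonormal e (c : J -> R[i]) s : orthonormal_family e -> uniq s ->
  let y := \sum_(j <- s) c j *: e j in '[y, y] = \sum_(j <- s) `|c j| ^+ 2.
Proof.
move=> oe us /=; rewrite ip_sumr [LHS]big_seq [RHS]big_seq.
apply: eq_bigr => i si.
by rewrite ipZr ip_sum_orthonormal_coef// si normCK mulrC.
Qed.

(** The partial sum [p] is the orthogonal projection of [x] onto the span of the listed vectors, so
    ['[x, x]] splits by Pythagoras and dropping the square of [x - p] leaves the bound. *)
Lemma bessel e x s : orthonormal_family e -> uniq s ->
  \sum_(j <- s) `|'[x, e j]| ^+ 2 <= '[x, x].
Proof.
move=> oe us; set p := \sum_(j <- s) '[x, e j] *: e j.
have <- : '[p, p] = \sum_(j <- s) `|'[x, e j]| ^+ 2.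
  exact: ip_sum_orthonormal.
have pxp : '[p, x - p] = 0.
  rewrite ip_suml big_seq big1// => j sj.
  by rewrite ipZl ipBr (ipC (e j) x) (ipC _ p)
    ip_sum_orthonormal_coef// sj subrr mulr0.
have -> : '[x, x] = '[p, p] + '[x - p, x - p].
  rewrite -{1 2}(subrK p x); move: (x - p) pxp => q pq.
  by rewrite ipDl !ipDr pq (ipC q p) pq conjC0 addr0 add0r addrC.
by rewrite lerDl ip_ge0.
Qed.

End Orthonormal.

Lemma cauchy_schwarz_unit x y : '[y, y] = 1 -> `|'[x, y]| ^+ 2 <= '[x, x].
Proof.
move=> y1; have oy : orthonormal_family (fun _ : unit => y) by move=> [] [].
by have := @bessel _ _ x [:: tt] oy isT; rewrite big_seq1.
Qed.

End Inner.

(** * Unordered orthogonal series in a Hilbert space *)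

Section OrthogonalSeries.
Variables (R : realType) (H : hilbertType R) (J : choiceType).
Variables (e e' : J -> H) (x : H).
Hypotheses (oe : orthonormal_family e) (oe' : orthonormal_family e').

Let c j := '[x, e j].
Let S (F : {fset J}) := \sum_(j <- F) c j *: e' j.
Let N (F : {fset J}) := \sum_(j <- F) `|c j| ^+ 2.

(** Convergence along this filter is unordered summation: finite subsets are directed by inclusion,
    which allows an uncountable [J]. *)
Let tails : set_system {fset J} :=
  filter_from setT (fun F => [set G | (F `<=` G)%fset]).

Let tails_filter : ProperFilter tails.
Proof.
apply: filter_from_proper; last by move=> F _; exists F => /=.
apply: filter_from_filter; first by exists fset0.
move=> F G _ _; exists (F `|` G)%fset => // K /=.
by rewrite fsubUset => /andP[].
Qed.

Let ip_S F G : (F `<=` G)%fset -> '[S F - S G, S F - S G] = N G - N F.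
Proof.
move=> FG; have split (V : nmodType) (f : J -> V) :
    \sum_(j <- G) f j = \sum_(j <- F) f j + \sum_(j <- (G `\` F)%fset) f j.
  rewrite (big_fsetID _ (mem F)) /=; congr (_ + _); apply: eq_fbigl => j.
    by rewrite !inE /= andbC; case: (boolP (j \in F)) => //= /(fsubsetP FG).
  by rewrite !inE andbC.
rewrite /N /S !split opprD addrA subrr add0r (addrC (\sum_(j <- F) _)) addrK.
rewrite ipNl ipNr opprK.
exact: (ip_sum_orthonormal c oe' (fset_uniq _)).
Qed.

(** Bessel bounds the sums [N F] by ['[x, x]], so some [F] comes within [eps] of their supremum. The
    supremum is taken in [R], through real parts, because [R[i]] is only partially ordered. *)
Let N_sup (eps : R[i]) : 0 < eps ->
  exists F, forall G, (F `<=` G)%fset -> N G - N F < eps.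
Proof.
have N_ge0 F : 0 <= N F by rewrite sumr_ge0// => j _; rewrite exprn_ge0.
have NR F : (complex.Re (N F))%:C%C = N F by rewrite RRe_real// ger0_real.
have xR : (complex.Re '[x, x])%:C%C = '[x, x].
  by rewrite RRe_real// ger0_real// ip_ge0.
move=> eps0; have epsR : (complex.Re eps)%:C%C = eps.
  by rewrite RRe_real// gtr0_real.
pose E := range (fun F => complex.Re (N F)).
have supE : has_sup E.
  split; first by exists (complex.Re (N fset0)), fset0.
  exists (complex.Re '[x, x]) => _ [F _ <-].
  by rewrite -lecR NR xR; apply: bessel => //; exact: fset_uniq.
have [|_ [F _ <-] FE] := @sup_adherent _ E (complex.Re eps) _ supE.
  by rewrite -ltcR epsR.
exists F => G _; rewrite -epsR -[N F]NR -[N G]NR.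
rewrite -(rmorphB (real_complex R)) ltcR.
have : complex.Re (N G) <= sup E by apply: ub_le_sup; [case: supE | exists G].
lra.
Qed.

(** The vector [y] is the sum of the [c j *: e' j]: the coefficients of [x] along [e] are
    transferred to [e']. With [e' = e] this yields Parseval; with [e'] a rearrangement of [e] it
    yields a unitary. *)
Lemma orthogonal_series_exists : exists y : H,
  [/\ forall j, '[y, e' j] = '[x, e j], '[y, y] <= '[x, x] &
      forall eps : R[i], 0 < eps -> exists F : {fset J},
        '[y, y] < \sum_(j <- F) `|'[x, e j]| ^+ 2 + eps].
Proof.
have [y Sy] : exists y : H, S @ tails --> y.
  have FS : ProperFilter (S @ tails) by exact: fmap_proper_filter.
  suff cS : cauchy (S @ tails).
    by exists (lim (S @ tails)); exact: (@cauchy_cvg H _ FS cS).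
  apply: cauchy_exP => eps eps0.
  have [F FN] : exists F, forall G, (F `<=` G)%fset -> N G - N F < eps ^+ 2.
    by apply: N_sup; rewrite exprn_gt0.
  exists (S F); exists F => // G /= FG; apply/ball_ip => //.
  by rewrite ip_S// FN.
have {}Sy (eps : R[i]) (F : {fset J}) : 0 < eps ->
    exists2 G, (F `<=` G)%fset & '[y - S G, y - S G] < eps.
  move=> eps0; have d0 : 0 < sqrtC eps by rewrite sqrtC_gt0.
  have [K _ KS] := Sy _ (nbhsx_ballx y _ d0).
  exists (F `|` K)%fset; rewrite ?fsubsetUl// -[eps]sqrtCK; apply/ball_ip => //.
  by apply: KS => /=; rewrite fsubsetUr.
have coefS G j : j \in G -> '[S G, e' j] = c j.
  by move=> jG; rewrite ip_sum_orthonormal_coef ?fset_uniq// jG.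
have coefy j : '[y, e' j] = c j.
  (* Were the coefficients different, the square of their gap could serve as the tolerance: for some
     [G] containing [j], [y - S G] would have a smaller square than its own coefficient along
     [e' j], against Cauchy-Schwarz. *)
  apply/eqP; rewrite -subr_eq0; apply/negP => /negP yj0.
  have := Sy (`|'[y, e' j] - c j| ^+ 2) [fset j]%fset.
  rewrite exprn_gt0 ?normr_gt0// => /(_ isT) [G jG].
  rewrite -(coefS G) ?(fsubsetP jG) ?inE// -ipBl.
  have ej : '[e' j, e' j] = 1 by rewrite oe' eqxx.
  by move=> /(le_lt_trans (cauchy_schwarz_unit _ ej)); rewrite ltxx.
have pythagoras G : '[y, y] = N G + '[y - S G, y - S G].
  have SN : '[S G, S G] = N G by exact: ip_sum_orthonormal.
  have yS : '[y, S G] = N G.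
    rewrite -SN [in RHS]ip_sumr ip_sumr !big_seq; apply: eq_bigr => j jG.
    by rewrite !ipZr coefS// coefy.
  have NJ : (N G)^* = N G by rewrite -SN -ipC.
  by rewrite ipBl !ipBr SN yS (ipC (S G)) yS NJ subrr subr0 addrC subrK.
exists y; split=> //.
  apply/ler_addgt0Pr => eps eps0; have [G _ yG] := Sy _ fset0 eps0.
  rewrite (pythagoras G) lerD//; last exact: ltW.
  by apply: bessel; rewrite ?fset_uniq.
move=> eps eps0; have [G _ yG] := Sy _ fset0 eps0.
by exists G; rewrite (pythagoras G) ltrD2l.
Qed.

End OrthogonalSeries.

(** * Parseval's identity and unitaries that permute an orthonormal basis *)

Section Permutation.
Variables (R : realType) (H : hilbertType R).

Lemma isometry_of_norm (u : H -> H) : linear u ->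
  (forall x, '[u x, u x] = '[x, x]) -> forall x y, '[u x, u y] = '[x, y].
Proof.
move=> lu nu x y.
have uD a b : u (a + b) = u a + u b by have := lu 1 a b; rewrite !scale1r.
have u0 : u 0 = 0 by apply: (addrI (u 0)); rewrite -uD !addr0.
have uZ (k : R[i]) a : u (k *: a) = k *: u a.
  by have := lu k a 0; rewrite !addr0 u0 addr0.
(* A sesquilinear [D] that vanishes on the diagonal is zero: [D y x = - D x y],
   and replacing [y] by ['i *: y] yields [D y x = D x y]. *)
pose D a b := '[u a, u b] - '[a, b].
have DC a b : D b a = - D a b.
  apply/eqP; rewrite -subr_eq0 opprK; apply/eqP.
  have := nu (a + b); rewrite uD !ipDl !ipDr !nu => /eqP.
  rewrite -subr_eq0 => /eqP <-; rewrite /D; ring.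
have DZl k a b : D (k *: a) b = k * D a b.
  by rewrite /D uZ !ipZl mulrBr.
have DZr k a b : D a (k *: b) = k^* * D a b.
  by rewrite /D uZ !ipZr mulrBr.
have : D x ('i *: y) = - D ('i *: y) x by rewrite DC.
rewrite DZr DZl conjCi (DC x) mulrN opprK mulNr => /eqP.
rewrite eq_sym -subr_eq0 opprK -mulr2n mulrn_eq0 mulf_eq0.
by rewrite (negbTE (neq0Ci _)) subr_eq0 => /eqP.
Qed.

Definition total_family (J : Type) (e : J -> H) :=
  forall x, (forall j, '[x, e j] = 0) -> x = 0.

Lemma total_family_inj (J : Type) (e : J -> H) x y : total_family e ->
  (forall j, '[x, e j] = '[y, e j]) -> x = y.
Proof.
move=> te xy; apply/eqP; rewrite -subr_eq0; apply/eqP/te => j.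
by rewrite ipBl xy subrr.
Qed.

Lemma parseval (J : choiceType) (e : J -> H) x (eps : R[i]) :
  orthonormal_family e -> total_family e -> 0 < eps ->
  exists F : {fset J}, '[x, x] < \sum_(j <- F) `|'[x, e j]| ^+ 2 + eps.
Proof.
move=> oe te; have [y [ye _ yF]] := orthogonal_series_exists x oe oe.
by move: yF; rewrite (total_family_inj te ye); apply.
Qed.

(** The operator moves the coefficient at [j] to [s j]. It is its own inverse, so the inequality
    ['[u x, u x] <= '[x, x]], applied to [x] and to [u x], already makes it norm-preserving. *)
Lemma unitary_of_involution (J : choiceType) (e : J -> H) (s : J -> J) :
  orthonormal_family e -> total_family e -> involutive s ->
  exists u : unitary_group H,
    forall x j, '[unitary_fun u x, e (s j)] = '[x, e j].
Proof.
move=> oe te ss; have oes : orthonormal_family (e \o s).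
  by move=> i j /=; rewrite oe (can_eq ss).
have exu x : exists y,
    (forall j, '[y, e (s j)] = '[x, e j]) /\ '[y, y] <= '[x, x].
  by have [y [ye yx _]] := orthogonal_series_exists x oe oes; exists y.
pose u x := projT1 (cid (exu x)).
have uE x j : '[u x, e (s j)] = '[x, e j] by rewrite /u; case: cid => y [].
have ule x : '[u x, u x] <= '[x, x] by rewrite /u; case: cid => y [].
have uK : involutive u.
  by move=> x; apply: (total_family_inj te) => j; rewrite -{1}(ss j) !uE.
have lu : linear u.
  move=> a x y; apply: (total_family_inj te) => j.
  by rewrite -(ss j) uE !ipDl !ipZl !uE.
have nu x : '[u x, u x] = '[x, x].
  by apply/le_anti; rewrite ule -{1 2}(uK x) ule.
have uu : unitary u.
  by split=> //; [exists u | exact: isometry_of_norm].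
by exists (exist _ u (mem_set uu)).
Qed.

Lemma unitary_opp : exists u : unitary_group H, forall x, unitary_fun u x = - x.
Proof.
have uu : unitary (-%R : H -> H).
  split; first by move=> a x y; rewrite opprD scalerN.
    by exists -%R; exact: opprK.
  apply: isometry_of_norm => [a x y|x]; first by rewrite opprD scalerN.
  by rewrite ipNl ipNr opprK.
by exists (exist _ (-%R : H -> H) (mem_set uu)).
Qed.

End Permutation.

(** * An orthonormal basis made of blocks and finitely many further vectors *)

Section Structure.
Variables (R : realType) (H : hilbertType R).

Definition block_orthonormal (T : eqType) (Z : set (T -> H)) :=
  forall f g s t, Z f -> Z g -> '[f s, g t] = ((f == g) && (s == t))%:R.

Lemma maximal_blocks (T : eqType) (t0 : T) :
  exists2 Z : set (T -> H), block_orthonormal Z &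
    forall h : T -> H, orthonormal_family h ->
      ~ (forall f s t, Z f -> '[f s, h t] = 0).
Proof.
have [F FP Fchain|Z [oZ Zmax]] := @Zorn_bigcup (T -> H) (@block_orthonormal T).
  move=> f g s t [A FA Af] [B FB Bg].
  by have [AB|BA] := Fchain _ _ FA FB; [apply: (FP _ FB) => //; exact: AB |
    apply: (FP _ FA) => //; exact: BA].
exists Z => // h oh hZ.
(* If [h] were in [Z], the unit vector [h t0] would be orthogonal to itself. *)
have Zh : ~ Z h.
  by move=> /(hZ _ t0 t0); rewrite oh eqxx => /eqP; rewrite oner_eq0.
apply: (Zmax (h |` Z)).
  by split=> [? ?|]; [right | move=> /(_ h (or_introl erefl))].
have neq f : Z f -> (f == h) = false.
  by move=> Zf; apply/eqP => fh; rewrite fh in Zf.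
move=> f g s t [->|Zf] [->|Zg]; last exact: oZ.
- by rewrite oh eqxx.
- by rewrite ipC hZ// eq_sym neq// conjC0.
- by rewrite hZ// neq.
Qed.

(** Unit vectors of [W] are chosen greedily, each orthogonal to the earlier ones. Either some finite
    list cannot be extended, or the choice goes on forever; closure under scaling lets a new vector
    be normalised. *)
Lemma infinite_or_finite_orthonormal (W : set H) :
  (forall (a : R[i]) x, W x -> W (a *: x)) ->
  (exists2 a : nat -> H, orthonormal_family a & forall n, W (a n)) \/
  exists s : seq H, [/\ orthonormal_family (fun i : 'I_(size s) => s`_i),
    forall v, v \in s -> W v &
    forall x, W x -> (forall v, v \in s -> '[x, v] = 0) -> x = 0].
Proof.
move=> WZ; pose good s := (forall v, v \in s -> W v /\ '[v, v] = 1) /\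
  pairwise (fun x y => '[x, y] == 0) s.
have [[s [sW sp smax]]|nomax] := pselect (exists s, [/\
    forall v, v \in s -> W v /\ '[v, v] = 1,
    pairwise (fun x y => '[x, y] == 0) s &
    forall x, W x -> (forall v, v \in s -> '[x, v] = 0) -> x = 0]).
  right; exists s; split=> //; last by move=> v /sW[].
  have lt i j : (i < j < size s)%N -> '[s`_i, s`_j] = 0.
    move=> /andP[ij js]; apply/eqP; move/(pairwiseP 0): sp; apply=> //.
    by rewrite inE (ltn_trans ij).
  move=> i j; have [ij|ji|/ord_inj ->] := ltngtP i j.
  - by rewrite lt ?ij ?ltn_ord// -val_eqE /= ltn_eqF.
  - by rewrite ipC lt ?ji ?ltn_ord// -val_eqE /= gtn_eqF// conjC0.
  - by rewrite eqxx; have [] := sW _ (mem_nth 0 (ltn_ord j)).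
(* The hypothesis [good s] sits under the existential so that [next] is a total function of the
   list; on bad lists it takes the junk value 0. *)
have ext s : exists x, good s ->
    [/\ W x, '[x, x] = 1 & forall v, v \in s -> '[x, v] = 0].
  have [[sW sp]|] := pselect (good s); last by exists 0.
  apply: contrapT => noext; apply: nomax; exists s; split=> // x Wx xs.
  apply/eqP/negP => /negP x0; apply: noext.
  have xx0 : 0 < '[x, x] by rewrite lt_def ip_eq0 x0 ip_ge0.
  have r0 : sqrtC '[x, x] != 0 by rewrite sqrtC_eq0 gt_eqF.
  have rJ : (sqrtC '[x, x])^* = sqrtC '[x, x].
    by apply: geC0_conj; rewrite sqrtC_ge0 ltW.
  exists ((sqrtC '[x, x])^-1 *: x) => _; split; first exact: WZ.
    rewrite ipZl ipZr fmorphV /= rJ -[X in _ * (_ * X)]sqrtCK; by field.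
  by move=> v vs; rewrite ipZl (xs v) ?mulr0.
pose next s := projT1 (cid (ext s)).
have nextP s : good s -> [/\ W (next s), '[next s, next s] = 1 &
    forall v, v \in s -> '[next s, v] = 0] by rewrite /next; case: cid.
pose L n := iter n (fun s => next s :: s) [::].
have goodL n : good (L n).
  elim: n => [//|n IHn]; have [Wx x1 xs] := nextP _ IHn.
  case: IHn => sW sp; split; last first.
    by rewrite /= sp andbT; apply/allP => v vs; rewrite xs.
  by move=> v /=; rewrite inE => /orP[/eqP -> //|/sW].
have memL m n : (m < n)%N -> next (L m) \in L n.
  elim: n => // n IHn; rewrite ltnS leq_eqVlt => /orP[/eqP ->|/IHn Ln].
    by rewrite /= mem_head.
  by rewrite /= inE Ln orbT.
left; exists (next \o L) => [m n|n] /=; last by have [] := nextP _ (goodL n).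
have [mn|nm|->] := ltngtP m n.
- by rewrite ipC; have [_ _ ->] := nextP _ (goodL n); rewrite ?conjC0 ?memL.
- by have [_ _ ->] := nextP _ (goodL m); rewrite ?memL.
- by have [] := nextP _ (goodL n).
Qed.

End Structure.

Lemma basis_of_blocks (R : realType) (H : hilbertType R) (T : countType)
    (t0 : T) :
  exists (I : choiceType) (d : nat) (e : (I * T + 'I_d)%type -> H),
    orthonormal_family e /\ total_family e.
Proof.
have [Z oZ Zmax] := @maximal_blocks R H T t0.
pose W : set H := [set x | forall f t, Z f -> '[x, f t] = 0].
have WZ (a : R[i]) x : W x -> W (a *: x).
  by move=> Wx f t Zf; rewrite ipZl Wx// mulr0.
have [[a oa Wa]|[s [os sW smax]]] := infinite_or_finite_orthonormal WZ.
  (* The injection of the countable [T] into [nat] turns an infinite sequence into a family indexed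
     by [T], which maximality of [Z] forbids. *)
  have /Zmax[] : orthonormal_family (a \o @choice.pickle T).
    by move=> i j /=; rewrite oa (inj_eq (pcan_inj choice.pickleK)).
  by move=> f i j Zf /=; rewrite ipC Wa// conjC0.
exists (set_type Z), (size s),
  (fun j => match j with
            | inl ft => val ft.1 ft.2
            | inr k => s`_(k : 'I_(size s))
            end).
have ZP (f : set_type Z) : Z (val f) by exact: set_valP.
have sZ k f t : Z f -> '[s`_(k : 'I_(size s)), f t] = 0.
  by move=> Zf; apply: sW; rewrite ?mem_nth.
split=> [[[f t]|k] [[g u]|l]|x xe] /=.
- exact: oZ (ZP f) (ZP g).
- by rewrite ipC (sZ _ _ _ (ZP f)) conjC0.
- exact: sZ (ZP g).
- exact: os.
apply: smax => [f t Zf|v vs].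
  by have := xe (inl (exist _ f (mem_set Zf), t)).
have vs' : (index v s < size s)%N by rewrite index_mem.
by have := xe (inr (Ordinal vs')); rewrite /= nth_index.
Qed.

(** * Involutions of words and the mass estimates they give *)

Definition word := (bool * seq nat)%type.

(* [i :: _] embeds the words of colour [b] into those of the other colour, with
   disjoint images as [i] varies; this is its extension to an involution. *)
Definition swap_word (b : bool) (i : nat) (t : word) : word :=
  if t.1 == b then (~~ b, i :: t.2)
  else if t.2 is j :: w then if j == i then (b, w) else t else t.

Lemma swap_wordK b i : involutive (swap_word b i).
Proof.
case=> c w; rewrite /swap_word /=; case: (eqVneq c b) => [->|cb] /=.
  by rewrite -eqbF_neg; case: b; rewrite /= eqxx.
case: w => [|j w] /=; first by rewrite (negbTE cb).
case: (eqVneq j i) => [->|ji] /=; last by rewrite (negbTE cb) (negbTE ji).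
by rewrite eqxx; case: b c cb => -[].
Qed.

Section Swap.
Variables (R : realType) (H : hilbertType R) (I : choiceType) (d : nat).
Local Notation J := (I * word + 'I_d)%type.
Variable e : J -> H.
Hypotheses (oe : orthonormal_family e) (te : total_family e).

Definition swap (b : bool) (i : nat) (j : J) : J :=
  match j with inl (f, t) => inl (f, swap_word b i t) | inr k => inr k end.

Definition colour (b : bool) (j : J) : bool :=
  if j is inl (_, t) then t.1 == b else false.

Lemma swapK b i : involutive (swap b i).
Proof. by move=> [[f t]|k] //=; rewrite swap_wordK. Qed.

(** On a word of colour [b] the swap prepends [i], so [i] and the word can both be read off the
    image: different [i] give disjoint images. *)
Lemma swap_inj b i j i' j' : colour b j -> colour b j' ->
  swap b i j = swap b i' j' -> (i, j) = (i', j').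
Proof.
case: j j' => [[f [c w]]|k] [[g [c' w']]|k'] //= /eqP -> /eqP ->.
by rewrite /swap_word /= eqxx => -[-> -> ->].
Qed.

(** The images of the [F i] under the swaps are pairwise disjoint, so together they form one
    duplicate-free list [s] to which Bessel applies. *)
Lemma no_common_translate (y : H) (b : bool) n (F : 'I_n -> {fset J})
    (a : R[i]) :
  (forall i j, j \in F i -> colour b j) ->
  (forall i, a <= \sum_(j <- F i) `|'[y, e (swap b i j)]| ^+ 2) ->
  a *+ n <= '[y, y].
Proof.
move=> Fb Fa.
pose s := [seq swap b (i : 'I_n) j | i <- enum 'I_n, j <- F i].
have us : uniq s.
  apply: allpairs_uniq_dep => [|i _|]; [exact: enum_uniq | exact: fset_uniq |].
  move=> _ _ /allpairsPdep[i [j [_ jF ->]]]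
    /allpairsPdep[i' [j' [_ jF' ->]]] /=.
  by move=> /(swap_inj (Fb _ _ jF) (Fb _ _ jF'))[/ord_inj -> ->].
apply: le_trans (bessel y oe us).
rewrite big_allpairs_dep /= big_enum /= -[n in a *+ n]card_ord -sumr_const.
exact: ler_sum.
Qed.

Lemma swap_unitary b i : exists u : unitary_group H,
  forall x j, '[unitary_fun u x, e (swap b i j)] = '[x, e j].
Proof. exact: unitary_of_involution oe te (@swapK b i). Qed.

End Swap.

(** Termwise [|a|^2 <= 2 |b|^2 + 2 |a - b|^2], then Bessel for [x - z]. It shows that a point near
    one of large mass still has large mass on the same finite set. *)
Lemma sum_ip_le (R : realType) (H : hilbertType R) (J : eqType) (e : J -> H)
    x z s : orthonormal_family e -> uniq s ->
  \sum_(j <- s) `|'[x, e j]| ^+ 2 <=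
    (\sum_(j <- s) `|'[z, e j]| ^+ 2) *+ 2 + '[x - z, x - z] *+ 2.
Proof.
move=> oe us; have := bessel (x - z) oe us.
rewrite -(ler_pMn2r (_ : 0 < 2)%N)// => xz.
apply: le_trans (lerD (lexx _) xz).
rewrite -!sumrMnl -big_split /=; apply: ler_sum => j _; rewrite ipBl.
move: '[x, e j] '[z, e j] => a b.
have ab : `|a| ^+ 2 <= (`|b| + `|a - b|) ^+ 2.
  by rewrite ler_pXn2r ?nnegrE ?addr_ge0// -{1}(subrKC b a) ler_normD.
apply: le_trans ab _; rewrite -subr_ge0.
have -> : `|b| ^+ 2 *+ 2 + `|a - b| ^+ 2 *+ 2 - (`|b| + `|a - b|) ^+ 2 =
  (`|b| - `|a - b|) ^+ 2 by ring.
by rewrite real_exprn_even_ge0 ?realB ?normr_real.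
Qed.

(** * Neighbourhoods and translates on the unit sphere *)

Section Sphere.
Variables (R : realType) (H : hilbertType R).
Local Notation S := (unit_sphere (H := H)).

Lemma ip_sphere (x : S) : '[val x, val x] = 1.
Proof. by apply/unit_norm_ip; exact: (set_valP x). Qed.

Lemma sphere_entourage (a : R[i]) : 0 < a ->
  entourage
    [set xy : S * S | '[val xy.1 - val xy.2, val xy.1 - val xy.2] < a ^+ 2].
Proof.
move=> a0; exists [set xy : H * H | ball xy.1 a xy.2].
  by rewrite -entourage_ballE; exists a.
by move=> xy /= /ball_ip; apply.
Qed.

Lemma bigcap_translates n (g : 'I_n -> unitary_group H) (V : set (S * S))
    (A : set S) :
  \bigcap_(i in [set: 'I_n])
    (@unitary_sphere_action R H (g i) @` entourage_nbhd V A) !=set0 ->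
  exists y : S, forall i, exists x z : S,
    [/\ A x, V (x, z) & unitary_fun (g i) (val z) = val y].
Proof.
move=> [y yg]; exists y => i; have [z [x Ax Vxz] <-] := yg i I.
by exists x, z.
Qed.

End Sphere.

(** * The cover of the sphere and the failure of concentration for its members *)

Section Cover.
Variables (R : realType) (H : hilbertType R) (I : choiceType) (d : nat).
Local Notation J := (I * word + 'I_d)%type.
Local Notation S := (unit_sphere (H := H)).
Variable e : J -> H.
Hypotheses (oe : orthonormal_family e) (te : total_family e).

(** The mass has to reach the threshold on a finite set already, which avoids infinite sums. *)
Definition coloured_mass (b : bool) : set S :=
  [set x | exists F : {fset J}, (forall j, j \in F -> colour b j) /\
    4^-1 <= \sum_(j <- F) `|'[val x, e j]| ^+ 2].

(** Chosen so that [2 r (d + 1) = 1/4]: the [d] extra coordinates, each of squared modulus at most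
    [2 r], then carry at most 1/4. The successor keeps [r] well defined when [d = 0]. *)
Let r : R[i] := (8 * d.+1%:R)^-1.

(* [m] selects the sign and the real or imaginary part. *)
Definition half_space (k : 'I_d) (m : 'I_4) : set S :=
  [set x | r <= 'Re ('i ^+ m * '[val x, e (inr k)])].

Definition cover_set (k : bool + 'I_d * 'I_4) : set S :=
  match k with inl b => coloured_mass b | inr (k, m) => half_space k m end.

Let r_gt0 : 0 < r.
Proof. by rewrite invr_gt0 mulr_gt0// ltr0n. Qed.

Lemma coloured_mass_not_concentrated b :
  exists2 V : set (S * S), entourage V & exists g : 'I_17 -> unitary_group H,
  ~ (\bigcap_(i in [set: 'I_17]) (@unitary_sphere_action R H (g i) @`
     entourage_nbhd V (coloured_mass b)) !=set0).
Proof.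
pose u i := projT1 (cid (swap_unitary oe te b i)).
have uP i x j : '[unitary_fun (u i) x, e (swap b i j)] = '[x, e j].
  by rewrite /u; case: cid.
have q0 : 0 < 4^-1 :> R[i] by rewrite invr_gt0 ltr0n.
eexists; first exact: (sphere_entourage H q0).
exists (fun i => u i) => /bigcap_translates[y yP].
have {yP} /choice[F FP] (i : 'I_17) : exists F : {fset J},
    (forall j, j \in F -> colour b j) /\
    16^-1 <= \sum_(j <- F) `|'[val y, e (swap b i j)]| ^+ 2.
  have [x [z [[F [Fb Fx]] /= xz <-]]] := yP i.
  exists F; split=> //; under eq_bigr do rewrite uP.
  (* From [1/4 <= 2 N + 2 a] and [a < (1/4)^2 = 1/16] it follows that [N >= 1/16]; 17 such disjoint
     masses exceed 1. *)
  have := le_trans Fx (sum_ip_le (val x) (val z) oe (fset_uniq F)).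
  move: xz; set a := '[_, _]; set N := \sum_(j <- F) _ => aq Nq.
  have {}aq : a <= 16^-1 by apply: le_trans (ltW aq) _; rewrite exprVn -natrX.
  rewrite -(ler_pMn2r (_ : 0 < 2)%N)// -(lerD2r (16^-1 *+ 2)).
  apply: le_trans (le_trans _ Nq) _; last by rewrite lerD2l lerMn2r aq.
  by rewrite le_eqVlt; apply/orP; left; apply/eqP; field.
have := no_common_translate oe (fun i => (FP i).1) (fun i => (FP i).2).
by rewrite ip_sphere -[_ *+ 17]mulr_natr ler_pdivrMl ?ltr0n// mulr1 ler_nat.
Qed.

(** A move of norm below [r] changes the real part by less than [r], so the functional stays
    positive on the whole neighbourhood. The translates by the identity and by [-1] are therefore
    disjoint. *)
Lemma half_space_not_concentrated k m :
  exists2 V : set (S * S), entourage V & exists g : 'I_2 -> unitary_group H,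
  ~ (\bigcap_(i in [set: 'I_2]) (@unitary_sphere_action R H (g i) @`
     entourage_nbhd V (half_space k m)) !=set0).
Proof.
have [v vN] := unitary_opp H.
eexists; first exact: (sphere_entourage H r_gt0).
exists (fun i => if i == ord0 then 1%g else v) => /bigcap_translates[y yP].
have pos (x z : S) : half_space k m x ->
    '[val x - val z, val x - val z] < r ^+ 2 ->
    0 < 'Re ('i ^+ m * '[val z, e (inr k)]).
  rewrite /half_space /= => rx xz.
  have ek : '[e (inr k), e (inr k)] = 1 by rewrite oe eqxx.
  have xzk : `|'[val x, e (inr k)] - '[val z, e (inr k)]| < r.
    rewrite -ipBl -(@ltr_pXn2r _ 2) ?nnegrE// ?ltW//.
    exact: le_lt_trans (cauchy_schwarz_unit _ ek) xz.
  have : 'Re ('i ^+ m * ('[val x, e (inr k)] - '[val z, e (inr k)])) < r.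
    apply: le_lt_trans (leif_Re_Creal _) _.
    by rewrite normrM normrX normCi expr1n mul1r.
  rewrite mulrBr raddfB /= => /lt_le_trans/(_ rx).
  by rewrite ltrBlDr ltrDl.
have [x [z [Ax /= xz zy]]] := yP ord0.
have [x' [z' [Ax' /= xz' zy']]] := yP ord_max.
have := addr_gt0 (pos _ _ Ax xz) (pos _ _ Ax' xz').
have -> : val z' = - val z.
  by apply: oppr_inj; rewrite opprK -vN; exact: etrans zy' (esym zy).
by rewrite ipNl mulrN raddfN /= subrr ltxx.
Qed.

(** For a point outside every member, a finite set of indices carries less than 1/4 on each colour
    and at most 1/4 on the extra vectors. Parseval with tolerance 1/4 would then give [1 < 1]. *)
Lemma cover_set_cover : \bigcup_(A in range cover_set) A = [set: S].
Proof.
rewrite -subTset => x _; apply: contrapT => xA.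
have {}xA k : ~ cover_set k x.
  by move=> xk; apply: xA; exists (cover_set k) => //; exists k.
pose f j := `|'[val x, e j]| ^+ 2.
have f_ge0 j : 0 <= f j by rewrite exprn_ge0.
have mass b (G : {fset J}) : (forall j, j \in G -> colour b j) ->
    \sum_(j <- G) f j < 4^-1.
  move=> Gb; rewrite real_ltNge ?ger0_real ?invr_ge0 ?sumr_ge0//.
  by apply/negP => fG; apply: (xA (inl b)); exists G.
have rest k : f (inr k) <= r *+ 2.
  pose w := '[val x, e (inr k)].
  have rR m : 'Re ('i ^+ m * w) < r.
    have m4 : (m %% 4 < 4)%N by rewrite ltn_mod.
    rewrite (divn_eq m 4) exprD mulnC exprM (_ : 'i ^+ 4 = 1) ?expr1n ?mul1r.
      rewrite real_ltNge ?Creal_Re ?gtr0_real//.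
      by apply/negP; exact: (xA (inr (k, Ordinal m4))).
    by rewrite (exprM _ 2 2) sqrCi sqrrN expr1n.
  have r2 : r ^+ 2 <= r.
    rewrite expr2 ler_piMl ?(ltW r_gt0)// invf_le1 ?mulr_gt0 ?ltr0n//.
    by rewrite -natrM ler1n.
  have sq t : t \is Num.real -> t < r -> - t < r -> t ^+ 2 <= r.
    move=> tR tr ntr; apply: le_trans r2; rewrite -real_normK//.
    rewrite ler_pXn2r ?nnegrE ?(ltW r_gt0)// ltW// real_ltr_norml//.
    by rewrite ltrNl ntr.
  rewrite /f -/w normC2_Re_Im mulr2n lerD// sq//.
  (* The rotations by [1], [-1], [-i] and [i] bound [Re w], [- Re w], [Im w] and [- Im w] in
     turn. *)
  - by have := rR 0; rewrite expr0 mul1r.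
  - by have := rR 2; rewrite sqrCi mulN1r raddfN.
  - by have := rR 3; rewrite exprS sqrCi mulrN1 mulNr raddfN /= ReMil opprK.
  - by have := rR 1; rewrite expr1 ReMil.
have q0 : 0 < 4^-1 :> R[i] by rewrite invr_gt0 ltr0n.
have [F] := parseval (val x) oe te q0; rewrite ip_sphere.
rewrite (big_fsetID _ (colour true)) /=.
rewrite (big_fsetID _ (colour false) [fset j in F | ~~ colour true j]%fset) /=.
set F1 := [fset _ in F | colour true _]%fset.
set F2 := [fset _ in _ | colour false _]%fset.
set F3 := [fset _ in _ | ~~ colour false _]%fset.
have F1q : \sum_(j <- F1) f j < 4^-1.
  by apply: (mass true) => j; rewrite !inE => /andP[].
have F2q : \sum_(j <- F2) f j < 4^-1.
  by apply: (mass false) => j; rewrite !inE => /andP[].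
have F3q : \sum_(j <- F3) f j <= 4^-1.
  have F3r j : j \in F3 -> exists k, j = inr k.
    rewrite !inE; case: j => [[g [c w]]|k]; last by exists k.
    by rewrite /= => /andP[/andP[_]]; case: c.
  apply: (@le_trans _ _ (\sum_(j <- F3) r *+ 2)).
    by rewrite big_seq [leRHS]big_seq; apply: ler_sum => j /F3r[k ->].
  rewrite big_const_seq count_predT iter_addr_0.
  have F3d : (#|` F3| <= d)%N.
    pose K := [fset (inr k : J) | k in 'I_d]%fset.
    have Kd : (#|` K| <= d)%N.
      by apply: leq_trans (leq_imfset_card _ _ _) _; rewrite -cardE card_ord.
    apply: leq_trans Kd; apply: fsubset_leq_card.
    by apply/fsubsetP => j /F3r[k ->]; apply/imfsetP; exists k.
  apply: (@le_trans _ _ (r *+ 2 *+ d.+1)).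
    by apply: ler_wpMn2l; [rewrite mulrn_wge0 ?(ltW r_gt0) | exact: leqW].
  rewrite le_eqVlt; apply/orP; left; apply/eqP.
  rewrite -[_ *+ d.+1]mulr_natr -[r *+ 2]mulr_natr /r; field.
  by rewrite nat1r pnatr_eq0.
have q4 : 4^-1 + (4^-1 + 4^-1) + 4^-1 = 1 :> R[i] by field.
apply/negP; rewrite le_gtF// -[leRHS]q4 lerD2r.
by rewrite !lerD// ltW.
Qed.

End Cover.

Theorem corollary2p3 (R : realType) (H : hilbertType R) :
  ~ concentration_property (@unitary_sphere_action R H).
Proof.
move=> conc.
have [I [d [e [oe te]]]] := @basis_of_blocks R H word (true, [::]).
have fin : finite_set (range (cover_set e)).
  by apply: finite_image; exact: finite_finset.
have [_ [k _ <-] kP] := conc _ fin (cover_set_cover oe te).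
case: k kP => [b|[k m]] kP.
  have [V entV [g]] := coloured_mass_not_concentrated oe te b.
  by apply; exact: kP.
have [V entV [g]] := half_space_not_concentrated oe k m.
by apply; exact: kP.
Qed.
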